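(* Let $q$ be an odd prime power and let $\mathcal U_{a,b}$ (with $a\neq 0$) be a non-classical orthogonal Buekenhout-Metz unital in $\mathrm{PG}(2,q^2)$. Let $\{\ell_1,\ell_{-1},\ell',\ell''\}$ be any O'Nan configuration of $\mathcal U_{a,b}$ arising from the Feng–Li construction for $q$ odd (described in the context). Then this O'Nan configuration cannot be extended to a Triple O'Nan; that is, there is no Triple O'Nan configuration of $\mathcal U_{a,b}$ whose six lines include the four lines $\ell_1,\ell_{-1},\ell',\ell''$.
   Context: Points of $\mathrm{PG}(2,q^2)$ are written $(x,y,z)$ and lines $[l,m,n]$ (homogeneous coordinates), with incidence $lx+my+nz=0$. For $q$ odd and $a,b\in\mathbb F_{q^2}$ such that $d=(b-b^q)^2+4a^{q+1}$ is a non-square in $\mathbb F_q$, the orthogonal Buekenhout-Metz (BM) unital is $$\mathcal U_{a,b}=\{(x,ax^2+bx^{q+1}+r,1)\mid r\in\mathbb F_q,\ x\in\mathbb F_{q^2}\}\cup\{T_\infty=(0,1,0)\}.$$ It is classical if and only if $a=0$. An O'Nan configuration in a unital $\mathcal U$ is a set of four distinct lines forming a quadrilateral (no three concurrent) whose six pairwise intersection points all lie in $\mathcal U$. A Triple O'Nan configuration of $\mathcal U$ is a set of six lines arising as follows: there is a quadrangle of four points of $\mathcal U$ (no three collinear) such that, for each of the three partitions of the four points into two pairs, the two lines joining the pairs meet in a point of $\mathcal U$; the six lines joining pairs of the four points form the Triple O'Nan. Feng–Li construction for $q$ odd: let $\sigma:(x,y,z)\mapsto(-x,y,z)$, $P=(0,0,1)$,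 $\ell_1=[1,1,0]$, $\ell_{-1}=[1,-1,0]=\sigma(\ell_1)$. For $\lambda\in\mathbb F_q$ put $$x_\lambda=-\frac{a^q+\lambda-b}{a^{q+1}-(\lambda-b)^{q+1}},\qquad P_\lambda=(x_\lambda,-x_\lambda,1)\in\ell_1\cap\mathcal U_{a,b},\qquad P_\lambda^\sigma=\sigma(P_\lambda).$$ Choose distinct $\lambda_1,\lambda_2\in\mathbb F_q$ with $x_{\lambda_1}+x_{\lambda_2}\ne0$ and $r=-\dfrac{2x_{\lambda_1}x_{\lambda_2}}{x_{\lambda_1}+x_{\lambda_2}}\in\mathbb F_q^*$, and put $R=(0,r,1)\in\mathcal U_{a,b}$. Let $\ell'=P_{\lambda_1}P_{\lambda_2}^\sigma$ and $\ell''=P_{\lambda_1}^\sigma P_{\lambda_2}=\sigma(\ell')$, which meet in $R$. Then $\ell_1=P_{\lambda_1}P_{\lambda_2}$, $\ell_{-1}=P_{\lambda_1}^\sigma P_{\lambda_2}^\sigma$, $\ell'$, $\ell''$ form an O'Nan configuration with points $P,R,P_{\lambda_1},P_{\lambda_2},P_{\lambda_1}^\sigma,P_{\lambda_2}^\sigma$. *)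

(* Defs.v *)
From HB Require Import structures.
From mathcomp Require Import all_boot all_order all_algebra all_field.

Set Implicit Arguments.
Unset Strict Implicit.
Unset Printing Implicit Defensive.

Import GRing.Theory.
Local Open Scope ring_scope.

HB.instance Definition _ (F : finFieldType) (vT : vectType F) :=
  Choice_isCountable.Build {vspace vT}
    (pcan_pickleK (can_pcan (@VectorInternalTheory.vs2mxK F vT))).
HB.instance Definition _ (F : finFieldType) (vT : vectType F) :
    isFinite {vspace vT} :=
  CanIsFinite (@VectorInternalTheory.vs2mxK F vT).

(* Points and lines of PG(2,F) are the subspaces of F^3 of dimension 1 and 2.
   Incidence is inclusion, the join of two distinct points is their sum and
   the meet of two distinct lines is their intersection. *)
Notation subspace F := {vspace 'rV[F]_3}.

Definition hvec (F : finFieldType) (x y z : F) : 'rV[F]_3 :=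
  \row_(i < 3) [:: x; y; z]`_i.

Definition pt (F : finFieldType) (x y z : F) : subspace F :=
  <[hvec x y z]>%VS.

(* [l,m,n] = {(x,y,z) | l x + m y + n z = 0}. *)
Definition ln (F : finFieldType) (l m n : F) : subspace F :=
  lker (linfun (mulmxr (hvec l m n)^T : 'rV[F]_3 -> 'rV[F]_1)).

Definition is_line (F : finFieldType) (L : subspace F) : bool := (\dim L == 2)%N.

Definition noncollinear (F : finFieldType) (A B C : subspace F) : bool :=
  (\dim (A + B + C)%VS == 3)%N.

Definition concurrent (F : finFieldType) (L M N : subspace F) : bool :=
  (L :&: M :&: N)%VS != 0%VS.

(* sigma : (x,y,z) |-> (-x,y,z) *)
Definition sigma (F : finFieldType) (W : subspace F) : subspace F :=
  (linfun (mulmxr (diag_mx (hvec (-1) 1 1)) : 'rV[F]_3 -> 'rV[F]_3) @: W)%VS.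

(* The subfield F_q of F when #|F| = q ^ 2. *)
Definition Fq (F : finFieldType) (q : nat) : pred F := [pred x | x ^+ q == x].

Definition nonsquare_Fq (F : finFieldType) (q : nat) (d : F) : bool :=
  (d \in Fq q) && ~~ [exists s : F, (s \in Fq q) && (d == s ^+ 2)].

Definition bm_disc (F : finFieldType) (q : nat) (a b : F) : F :=
  (b - b ^+ q) ^+ 2 + 4%:R * a ^+ q.+1.

Definition bm_unital (F : finFieldType) (q : nat) (a b : F) :
    {set subspace F} :=
  [set pt x (a * x ^+ 2 + b * x ^+ q.+1 + r) 1 | x : F, r : F in Fq q]
    :|: [set pt 0 1 0].

Definition onan (F : finFieldType) (U S : {set subspace F}) : Prop :=
  [/\ #|S| = 4%N,
      {in S, forall L, is_line L},
      {in S & &, forall L M N,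
         L != M -> L != N -> M != N -> ~~ concurrent L M N}
    & {in S &, forall L M, L != M -> (L :&: M)%VS \in U}].

(* A B C D is a quadrangle (so the four points are distinct) whose three
   diagonal points lie in U; T consists of its six joining lines. *)
Definition triple_onan (F : finFieldType) (U T : {set subspace F}) : Prop :=
  exists A B C D : subspace F,
    [/\ [/\ A \in U, B \in U, C \in U & D \in U],
        [/\ noncollinear A B C, noncollinear A B D,
            noncollinear A C D & noncollinear B C D],
        [/\ ((A + B) :&: (C + D))%VS \in U,
            ((A + C) :&: (B + D))%VS \in U
          & ((A + D) :&: (B + C))%VS \in U]
      & T = [set (A + B)%VS; (C + D)%VS; (A + C)%VS; (B + D)%VS;
                 (A + D)%VS; (B + C)%VS]].

(* For lam in F_q, fl_P q a b lam = (x_lam, - x_lam, 1) is the point of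
   [1,1,0] and of the unital at parameter lam. *)
Definition fl_x (F : finFieldType) (q : nat) (a b lam : F) : F :=
  - ((a ^+ q + lam - b) / (a ^+ q.+1 - (lam - b) ^+ q.+1)).

Definition fl_P (F : finFieldType) (q : nat) (a b lam : F) : subspace F :=
  pt (fl_x q a b lam) (- fl_x q a b lam) 1.

(* The joins P1 P2^sigma and P1^sigma P2 are exchanged by sigma. *)
Definition fl_lines (F : finFieldType) (q : nat) (a b lam1 lam2 : F) :
    {set subspace F} :=
  let P1 := fl_P q a b lam1 in
  let P2 := fl_P q a b lam2 in
  [set ln 1 1 0; ln 1 (-1) 0; (P1 + sigma P2)%VS; (sigma P1 + P2)%VS].

Definition feng_li (F : finFieldType) (q : nat) (a b : F)
    (S : {set subspace F}) : Prop :=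
  exists lam1 lam2 : F,
    let x1 := fl_x q a b lam1 in
    let x2 := fl_x q a b lam2 in
    let r := - (2%:R * x1 * x2 / (x1 + x2)) in
    [/\ [/\ lam1 \in Fq q, lam2 \in Fq q & lam1 != lam2],
        x1 + x2 != 0,
        r \in Fq q /\ r != 0
      & S = fl_lines q a b lam1 lam2].

(* Main.v *)
(* Four of the six lines of a quadrangle, no three concurrent, form a 4-cycle.
   So an extension to a triple O'Nan has a diagonal point where two of the
   three diagonals of the quadrilateral l_1, l_{-1}, l', l'' meet.  Those
   diagonals are x = 0, y + x1 z = 0 and y + x2 z = 0, with meets (1,0,0),
   (0,-x1,1) and (0,-x2,1).  The first is not on the unital; either of the
   others is on it only if x1 or x2 lies in F_q, which forces a + b into F_q
   and hence d = (a + a^q)^2, a square. *)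
Require Import Defs.
From mathcomp Require Import all_boot all_order all_algebra all_field.
From mathcomp Require Import ring.

Set Implicit Arguments.
Unset Strict Implicit.

Import GRing.Theory.
Local Open Scope ring_scope.

(** * Points, lines, joins and concurrence in coordinates *)

Section Coordinates.
Variable F : finFieldType.
Implicit Types (x y z l m n : F) (v : 'rV[F]_3) (A B C L M N : subspace F).

Lemma mem_ln l m n v :
  (v \in ln l m n) = (l * v 0 0 + m * v 0 1 + n * v 0 2%:R == 0).
Proof.
rewrite memv_ker lfunE /=; apply/eqP/eqP => [/matrixP/(_ 0 0)|H].
  rewrite !mxE !big_ord_recl big_ord0 !mxE /= addr0 addrA => <-.
  rewrite !(mulrC (v _ _)); congr (_ + _ * v _ _ + _ * v _ _); exact: val_inj.
apply/matrixP => i j; rewrite !ord1 !mxE !big_ord_recl big_ord0 !mxE /= addr0.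
rewrite -H addrA !(mulrC (v _ _)).
by congr (_ + _ * v _ _ + _ * v _ _); exact: val_inj.
Qed.

Lemma pt_sub_ln l m n x y z :
  (pt x y z <= ln l m n)%VS = (l * x + m * y + n * z == 0).
Proof. by rewrite -memvE mem_ln !mxE. Qed.

Lemma sigma_pt x y z : sigma (pt x y z) = pt (- x) y z.
Proof.
rewrite /sigma /pt limg_line lfunE /=; congr (<[_]>%VS).
apply/rowP => i; rewrite mul_mx_diag !mxE.
by case: i => [[|[|[|]]]] //= _; rewrite ?mulrN ?mulr1.
Qed.

Lemma join_sub_ln l m n x y z x' y' z' :
  l * x + m * y + n * z = 0 -> l * x' + m * y' + n * z' = 0 ->
  (pt x y z + pt x' y' z' <= ln l m n)%VS.
Proof. by move=> /eqP H /eqP H'; rewrite subv_add !pt_sub_ln H H'. Qed.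

(** If [L] were [A + C], it would absorb [B], and [A + B + C] would have dimension at most 2. *)
Lemma noncollinear_join_neq A B C L :
    \dim A = 1%N -> \dim C = 1%N -> noncollinear A B C -> (B <= L)%VS ->
  (A + C)%VS != L.
Proof.
move=> dA dC /eqP dABC sBL; apply: contra_eq_neq dABC => E; rewrite -{}E in sBL.
move/addv_idPl: sBL => sB.
have := dimv_add_leqif A C; rewrite dA dC => -[le2 _].
by rewrite -addvA (addvC B) addvA sB neq_ltn ltnS le2.
Qed.

Lemma noncollinear_swapl A B C : noncollinear A B C = noncollinear B A C.
Proof. by rewrite /noncollinear (addvC A). Qed.

Lemma noncollinear_swapr A B C : noncollinear A B C = noncollinear A C B.
Proof. by rewrite /noncollinear -!addvA (addvC B). Qed.

Lemma concurrent_through A L M N :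
  A != 0%VS -> (A <= L)%VS -> (A <= M)%VS -> (A <= N)%VS -> concurrent L M N.
Proof.
move=> A0 sL sM sN; apply: contraNneq A0 => E.
by rewrite -subv0 -E !subv_cap sL sM sN.
Qed.

End Coordinates.

(** * The unital on the axis x = 0 and on the lines through (1,0,0) *)

Section Unital.
Variables (F : finFieldType) (q : nat) (a b : F).
Local Notation U := (bm_unital q a b).

Lemma bm_unitalP A : A \in U ->
  A = pt 0 1 0 \/
  exists x r, r \in Fq q /\ A = pt x (a * x ^+ 2 + b * x ^+ q.+1 + r) 1.
Proof.
case/setUP => [/imset2P [x r _ hr ->]|/set1P->]; last by left.
by right; exists x, r.
Qed.

Lemma bm_unital_dim A : A \in U -> \dim A = 1%N.
Proof.
have nz x y z : (y != 0) || (z != 0) -> \dim (pt x y z) = 1%N.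
  move=> yz; rewrite dim_vline; case: eqP => // /rowP E; move: yz.
  by have := E 1; have := E 2%:R; rewrite !mxE /= => -> ->; rewrite eqxx.
by case/bm_unitalP => [->|[x [r [_ ->]]]]; apply: nz; rewrite oner_eq0 ?orbT.
Qed.

(** At x = 0 the affine points of the unital are (0,r,1) with r in F_q, and the line [0,1,y] misses
    (0,1,0); so [A] is (0,-y,1) with -y = r. *)
Lemma bm_unital_axis A y : A \in U ->
  (A <= (ln 1 0 0)%R)%VS -> (A <= (ln 0 1 y)%R)%VS -> - y \in Fq q.
Proof.
case/bm_unitalP => [->|[x [r [hr ->]]]]; rewrite !pt_sub_ln.
  by rewrite !mul0r !mulr0 mulr1 !add0r !addr0 oner_eq0.
rewrite !mul0r mul1r !addr0 => /eqP->.
by rewrite !expr0n /= !mulr0 mul1r mulr1 !add0r addr_eq0 => /eqP <-.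
Qed.

(** Distinct lines [0,1,y] and [0,1,y'] meet only in (1,0,0), which is not on the unital. *)
Lemma bm_unital_parallel A y y' : A \in U ->
  (A <= (ln 0 1 y)%R)%VS -> (A <= (ln 0 1 y')%R)%VS -> y = y'.
Proof.
case/bm_unitalP => [->|[x [r [hr ->]]]]; rewrite !pt_sub_ln.
  by rewrite !mul0r mulr0 mulr1 add0r addr0 oner_eq0.
by rewrite !mul0r !add0r !mulr1 !mul1r => /eqP <- /eqP /addrI.
Qed.

End Unital.

(** * The q-power Frobenius map and the parameter x_lambda *)

Section FengLiParameter.
Variables (F : finFieldType) (p k q : nat).
Hypotheses (p_pr : prime p) (k_gt0 : (0 < k)%N) (qE : q = (p ^ k)%N).
Hypothesis cardF : #|F| = (q ^ 2)%N.

Lemma pchar_of_card : p \in [pchar F].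
Proof. by apply: card_finPcharP p_pr; rewrite cardF qE -expnM. Qed.

Lemma pchar_nat_q : [pchar F].-nat q.
Proof. by rewrite qE pnatX pnatE // pchar_of_card. Qed.

Lemma FrobeniusqD (x y : F) : (x + y) ^+ q = x ^+ q + y ^+ q.
Proof. exact: exprDn_pchar pchar_nat_q. Qed.

Lemma FrobeniusqN (x : F) : (- x) ^+ q = - x ^+ q.
Proof. exact: exprNn_pchar pchar_nat_q. Qed.

Lemma FrobeniusqK (x : F) : (x ^+ q) ^+ q = x.
Proof. by rewrite -exprM -[RHS]expf_card cardF. Qed.

Lemma two_neq0 : odd q -> 2%:R != 0 :> F.
Proof.
apply: contraTneq => /eqP; rewrite -(dvdn_pcharf pchar_of_card).
by rewrite dvdn_prime2 // => /eqP p2; rewrite qE p2 oddX orbF -lt0n k_gt0.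
Qed.

(** Put c = lam - b. Then x n = -(a^q + c), where n is a difference of two norms and so lies in F_q.
    If x lay in F_q, then a^q + c would equal its conjugate a + c^q, so b - b^q = a^q - a, and the
    discriminant would be (a^q - a)^2 + 4 a^(q+1) = (a + a^q)^2. *)
Lemma fl_x_notin_Fq (a b lam : F) :
    nonsquare_Fq q (bm_disc q a b) -> lam \in Fq q ->
  fl_x q a b lam != 0 -> fl_x q a b lam \notin Fq q.
Proof.
move=> /andP[_ nsq] /eqP lamq x0; apply: contra nsq => /eqP.
move: x0; set x := fl_x _ _ _ _ => x0 xq.
set c := lam - b; set n := a ^+ q.+1 - c ^+ q.+1.
(* The inverse of 0 is 0, so a vanishing denominator would give x = 0. *)
have n0 : n != 0.
  by apply: contraNneq x0; rewrite /x /fl_x -/c -/n => ->; rewrite invr0 mulr0 oppr0.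
have xE : x * n = - (a ^+ q + c).
  by rewrite /x /fl_x -/c -/n addrA mulNr divfK.
have nq : n ^+ q = n.
  rewrite /n FrobeniusqD FrobeniusqN !exprS !exprMn !FrobeniusqK.
  by rewrite [a * _]mulrC [c * _]mulrC.
have cE : c ^+ q = lam - b ^+ q by rewrite FrobeniusqD FrobeniusqN lamq.
have E : a ^+ q + c = a + c ^+ q.
  have : (x * n) ^+ q = x * n by rewrite exprMn xq nq.
  by rewrite xE FrobeniusqN FrobeniusqD FrobeniusqK => /oppr_inj.
(* The square root is the trace of [a], which lies in F_q. *)
apply/existsP; exists (a + a ^+ q); rewrite inE FrobeniusqD FrobeniusqK addrC eqxx.
apply/eqP; rewrite /bm_disc [a ^+ _]exprS.
have -> : b - b ^+ q = a ^+ q - a.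
  by apply/eqP; rewrite eq_sym subr_eq -(addrK c (a ^+ q)) E cE /c; apply/eqP; ring.
ring.
Qed.

End FengLiParameter.

(** * Four joins of a quadrangle, no three of them concurrent *)

(** The three joins at a vertex are concurrent, so [S] contains at most two of them. Four edges of
    the complete graph on four vertices with all degrees at most 2 form a 4-cycle; each alternative
    leaves out one pair of opposite joins. *)
Lemma quadrangle_four_edges (F : finFieldType) (A B C D : subspace F)
    (S : {set subspace F}) :
    [/\ \dim A = 1%N, \dim B = 1%N, \dim C = 1%N & \dim D = 1%N] ->
    [/\ noncollinear A B C, noncollinear A B D,
        noncollinear A C D & noncollinear B C D] ->
    {in S & &, forall L M N,
       L != M -> L != N -> M != N -> ~~ concurrent L M N} ->
    #|S| = 4%N ->
    S \subset [set (A + B)%VS; (C + D)%VS; (A + C)%VS; (B + D)%VS;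
                   (A + D)%VS; (B + C)%VS] ->
  [\/ [/\ (A + C)%VS \in S, (B + D)%VS \in S, (A + D)%VS \in S & (B + C)%VS \in S],
      [/\ (A + B)%VS \in S, (C + D)%VS \in S, (A + D)%VS \in S & (B + C)%VS \in S]
    | [/\ (A + B)%VS \in S, (C + D)%VS \in S, (A + C)%VS \in S & (B + D)%VS \in S]].
Proof.
move=> [dA dB dC dD] [nABC nABD nACD nBCD] nconc cardS sST.
have star X Y1 Y2 Y3 : \dim X = 1%N -> \dim Y1 = 1%N -> \dim Y2 = 1%N ->
    \dim Y3 = 1%N -> noncollinear X Y1 Y2 -> noncollinear X Y1 Y3 ->
    noncollinear X Y2 Y3 ->
    ~~ [&& (X + Y1)%VS \in S, (X + Y2)%VS \in S & (X + Y3)%VS \in S].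
  move=> dX d1 d2 d3 n12 n13 n23; apply/and3P => -[h1 h2 h3].
  have neq Y Z : \dim Y = 1%N -> \dim Z = 1%N -> noncollinear X Y Z ->
      (X + Y)%VS != (X + Z)%VS.
    move=> dY dZ; rewrite noncollinear_swapr => nXZY.
    by apply: noncollinear_join_neq nXZY _; rewrite ?addvSr.
  have /negP := nconc _ _ _ h1 h2 h3 (neq _ _ d1 d2 n12) (neq _ _ d1 d3 n13)
    (neq _ _ d2 d3 n23).
  by apply; apply: (@concurrent_through _ X); rewrite ?addvSl // -dimv_eq0 dX.
have sA := star A B C D dA dB dC dD nABC nABD nACD.
have sB : ~~ [&& (A + B)%VS \in S, (B + C)%VS \in S & (B + D)%VS \in S].
  by rewrite (addvC A); apply: star; rewrite // noncollinear_swapl.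
have sC : ~~ [&& (A + C)%VS \in S, (B + C)%VS \in S & (C + D)%VS \in S].
  rewrite (addvC A) (addvC B).
  by apply: star; rewrite // noncollinear_swapl // noncollinear_swapr.
have sD : ~~ [&& (A + D)%VS \in S, (B + D)%VS \in S & (C + D)%VS \in S].
  rewrite (addvC A) (addvC B) (addvC C).
  by apply: star; rewrite // noncollinear_swapl noncollinear_swapr.
(* A lower bound on the count suffices, so the six joins need not be shown distinct. *)
have : (4 <= count [in S] [:: A + B; C + D; A + C; B + D; A + D; B + C]%VS)%N.
  rewrite -cardS cardE -size_filter; apply: uniq_leq_size; first exact: enum_uniq.
  move=> L; rewrite mem_enum mem_filter => LS; rewrite LS /=.
  by move/subsetP/(_ _ LS): sST; rewrite !inE -!orbA.
(* The rest is propositional: 64 truth assignments for the six memberships. *)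
move: sA sB sC sD => /=.
case: (_ \in S); case: (_ \in S); case: (_ \in S);
  case: (_ \in S); case: (_ \in S); case: (_ \in S) => //= *;
  by [apply: Or31 | apply: Or32 | apply: Or33].
Qed.

(** * The quadrilateral of the four lines and its diagonals *)

Section Quadrilateral.
Variables (F : finFieldType) (x1 x2 : F).
Hypotheses (two0 : 2%:R != 0 :> F) (x1_0 : x1 != 0) (x2_0 : x2 != 0).
Hypothesis x12 : x1 != x2.

(* Lines and diagonals are indexed by the Klein four-group, so that the meet of
   lines [i] and [j] is on diagonal [i + j]. *)
Definition quad_line (i : bool * bool) : subspace F :=
  match i with
  | (false, false) => ln 1 1 0
  | (false, true) => ln 1 (-1) 0
  | (true, false) => ((pt x1 (- x1) 1)%R + (pt (- x2) (- x2) 1)%R)%VS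
  | (true, true) => ((pt (- x1) (- x1) 1)%R + (pt x2 (- x2) 1)%R)%VS
  end.

Definition quad_diagonal (i : bool * bool) : subspace F :=
  match i with
  | (false, _) => ln 1 0 0
  | (true, false) => ln 0 1 x1
  | (true, true) => ln 0 1 x2
  end.

Definition klein_add (i j : bool * bool) := (i.1 (+) j.1, i.2 (+) j.2).

(** The equation of the diagonal, multiplied by a nonzero scalar 2u, is a linear combination of the
    equations of the two lines; u is one of 1, x1, x2 and x2 - x1. *)
Lemma meet_sub_diagonal A i j : i != j ->
  (A <= quad_line i)%VS -> (A <= quad_line j)%VS ->
  (A <= quad_diagonal (klein_add i j))%VS.
Proof.
have comb (u s t e f t' : F) : u != 0 -> e == 0 -> f == 0 ->
    2%:R * u * t' = s * e + t * f -> t' == 0.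
  move=> u0 /eqP-> /eqP-> /eqP.
  by rewrite !mulr0 addr0 !mulf_eq0 (negPf two0) (negPf u0).
(* The joins l' and l'' get explicit equations, which sigma exchanges up to sign of the first
   coefficient. *)
have x21 : x2 - x1 != 0 by rewrite subr_eq0 eq_sym.
have s10 : (quad_line (true, false) <=
    (ln (x2 - x1) (- (x1 + x2)) (- (2%:R * x1 * x2)))%R)%VS.
  by apply: join_sub_ln; ring.
have s11 : (quad_line (true, true) <=
    (ln (x1 - x2) (- (x1 + x2)) (- (2%:R * x1 * x2)))%R)%VS.
  by apply: join_sub_ln; ring.
move=> ij sAi sAj; apply/subvP => v vA.
move: {A sAi sAj vA} (subvP sAi v vA) (subvP sAj v vA).
(* Reading an index as a binary number orders each pair, and [klein_add] is commutative; six pairs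
   remain. *)
wlog {ij} : i j / (i.1.*2 + i.2 < j.1.*2 + j.2)%N => [H vi vj|].
  have [lt|lt|] := ltngtP (i.1.*2 + i.2)%N (j.1.*2 + j.2)%N.
  - exact: H.
  - by rewrite /klein_add addbC [i.2 (+) _]addbC; apply: H.
  - by move: i j ij {H vi vj} => [[] []] [[] []].
move: i j => [[] []] [[] []] // _ vi vj.
- move: vi vj => /(subvP s10) + /(subvP s11); rewrite !mem_ln => vi vj.
  by apply: (comb _ 1 (-1) _ _ _ x21 vi vj); ring.
- move: vi vj => + /(subvP s11); rewrite !mem_ln => vi vj.
  by apply: (comb _ (x1 - x2) (-1) _ _ _ x2_0 vi vj); ring.
- move: vi vj => + /(subvP s10); rewrite !mem_ln => vi vj.
  by apply: (comb _ (x2 - x1) (-1) _ _ _ x1_0 vi vj); ring.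
- move: vi vj => + /(subvP s11); rewrite !mem_ln => vi vj.
  by apply: (comb _ (x1 - x2) (-1) _ _ _ x1_0 vi vj); ring.
- move: vi vj => + /(subvP s10); rewrite !mem_ln => vi vj.
  by apply: (comb _ (x2 - x1) (-1) _ _ _ x2_0 vi vj); ring.
- move: vi vj; rewrite !mem_ln => vi vj.
  by apply: (comb _ 1 1 _ _ _ (oner_neq0 F) vi vj); ring.
Qed.

(** The diagonal x = 0 meets the others in (0,-x1,1) and (0,-x2,1), and these two meet each other in
    (1,0,0). Excluding the index (false, false) avoids the default value of [quad_diagonal], which
    repeats x = 0. *)
Lemma diagonals_meet_off_unital (q : nat) (a b : F) A i j :
    - x1 \notin Fq q -> - x2 \notin Fq q -> A \in bm_unital q a b ->
    i != (false, false) -> j != (false, false) -> i != j ->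
  (A <= quad_diagonal i)%VS -> (A <= quad_diagonal j)%VS -> False.
Proof.
move=> nx1 nx2 AU; wlog: i j / (i.1.*2 + i.2 < j.1.*2 + j.2)%N => [H i0 j0 ij|].
  have [lt|lt|] := ltngtP (i.1.*2 + i.2)%N (j.1.*2 + j.2)%N.
  - exact: H.
  - by move=> Ai Aj; apply: (H j i) => //; rewrite eq_sym.
  - by move: i j ij {H i0 j0} => [[] []] [[] []].
move: i j => [[] []] [[] []] // _ _ _ _ Ai Aj.
- by case/eqP: x12; apply: bm_unital_parallel AU Ai Aj.
- by case/negP: nx2; apply: bm_unital_axis AU Ai Aj.
- by case/negP: nx1; apply: bm_unital_axis AU Ai Aj.
Qed.

(** Let i, j, k, l be the indices of AC, BD, AD, BC. Opposite vertices of the quadrilateral share a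
    diagonal: [A] and [B] lie on diagonal i + k, [C] and [D] on diagonal i + l. Hence AB and CD are
    diagonals, and their meet is off the unital. *)
Lemma no_four_cycle (q : nat) (a b : F) (A B C D : subspace F)
    (S : {set subspace F}) :
    - x1 \notin Fq q -> - x2 \notin Fq q ->
    {subset S <= codom quad_line} ->
    [/\ \dim A = 1%N, \dim B = 1%N, \dim C = 1%N & \dim D = 1%N] ->
    [/\ noncollinear A B C, noncollinear A B D,
        noncollinear A C D & noncollinear B C D] ->
    [/\ (A + C)%VS \in S, (B + D)%VS \in S, (A + D)%VS \in S & (B + C)%VS \in S] ->
  ((A + B) :&: (C + D))%VS \notin bm_unital q a b.
Proof.
move=> nx1 nx2 sS [dA dB dC dD] [nABC nABD nACD nBCD] [AC BD AD BC].
have AC_AD : (A + C)%VS != (A + D)%VS.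
  by apply: (@noncollinear_join_neq _ A D C); rewrite ?addvSr // noncollinear_swapr.
have AC_BC : (A + C)%VS != (B + C)%VS.
  by apply: (@noncollinear_join_neq _ A B C); rewrite ?addvSl.
have AC_BD : (A + C)%VS != (B + D)%VS.
  by apply: (@noncollinear_join_neq _ A B C); rewrite ?addvSl.
have AD_BC : (A + D)%VS != (B + C)%VS.
  by apply: (@noncollinear_join_neq _ A B D); rewrite ?addvSl.
have AD_BD : (A + D)%VS != (B + D)%VS.
  by apply: (@noncollinear_join_neq _ A B D); rewrite ?addvSl.
have BC_BD : (B + C)%VS != (B + D)%VS.
  by apply: (@noncollinear_join_neq _ B D C); rewrite ?addvSr // noncollinear_swapr.
have [i Ei] := codomP (sS _ AC); have [j Ej] := codomP (sS _ BD).
have [k Ek] := codomP (sS _ AD); have [l El] := codomP (sS _ BC).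
have sub X m n : m != n -> (X <= quad_line m)%VS -> (X <= quad_line n)%VS ->
  (X <= quad_diagonal (klein_add m n))%VS by exact: meet_sub_diagonal.
rewrite Ei Ej Ek El in AC_AD AC_BC AC_BD AD_BC AD_BD BC_BD.
have ne m n : quad_line m != quad_line n -> m != n by apply: contraNneq => ->.
have sA : (A <= quad_diagonal (klein_add i k))%VS.
  by apply: sub; rewrite ?ne // -?Ei -?Ek addvSl.
have sB : (B <= quad_diagonal (klein_add i k))%VS.
  (* Four distinct indices exhaust the Klein group and sum to zero. *)
  have -> : klein_add i k = klein_add l j.
    move: (ne _ _ AC_AD) (ne _ _ AC_BC) (ne _ _ AC_BD) (ne _ _ AD_BC).
    move: (ne _ _ AD_BD) (ne _ _ BC_BD).
    by move: (i) (j) (k) (l) => [[] []] [[] []] [[] []] [[] []].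
  by apply: sub; rewrite ?ne // -?El -?Ej addvSl.
have sC : (C <= quad_diagonal (klein_add i l))%VS.
  by apply: sub; rewrite ?ne // -?Ei -?El addvSr.
have sD : (D <= quad_diagonal (klein_add i l))%VS.
  have -> : klein_add i l = klein_add k j.
    move: (ne _ _ AC_AD) (ne _ _ AC_BC) (ne _ _ AC_BD) (ne _ _ AD_BC).
    move: (ne _ _ AD_BD) (ne _ _ BC_BD).
    by move: (i) (j) (k) (l) => [[] []] [[] []] [[] []] [[] []].
  by apply: sub; rewrite ?ne // -?Ek -?Ej addvSr.
apply/negP => DU.
apply: (diagonals_meet_off_unital nx1 nx2 DU (i := klein_add i k)
  (j := klein_add i l)).
(* The sums i + k and i + l are nonzero since i differs from k and l, and distinct since k differs
   from l. *)
- by move: (i) (k) (ne _ _ AC_AD) => [[] []] [[] []].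
- by move: (i) (l) (ne _ _ AC_BC) => [[] []] [[] []].
- by move: (i) (k) (l) (ne _ _ AD_BC) => [[] []] [[] []] [[] []].
- by apply: subv_trans (capvSl _ _) _; rewrite subv_add sA sB.
- by apply: subv_trans (capvSr _ _) _; rewrite subv_add sC sD.
Qed.

End Quadrilateral.

(** * Exclusion of the three possible 4-cycles *)

Theorem theorem4 (F : finFieldType) (p k q : nat)
    (hp : prime p) (hk : (0 < k)%N) (hq : q = (p ^ k)%N) (hodd : odd q)
    (hF : #|F| = (q ^ 2)%N)
    (a b : F) (ha : a != 0) (hd : nonsquare_Fq q (bm_disc q a b))
    (S : {set subspace F})
    (hS : onan (bm_unital q a b) S) (hfl : feng_li q a b S) :
  ~ exists T : {set subspace F},
      triple_onan (bm_unital q a b) T /\ S \subset T.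
Proof.
move=> [T [[A [B [C [D [[AU BU CU DU] nc [d1 d2 d3] ->]]]]] sST]].
have [cardS _ nconc _] := hS.
have [lam1 [lam2 []]] := hfl.
set x1 := fl_x q a b lam1; set x2 := fl_x q a b lam2.
move=> [l1q l2q _] _ [_ r0] SE.
have x1_0 : x1 != 0.
  by apply: contraNneq r0 => ->; rewrite mulr0 !mul0r oppr0.
have x2_0 : x2 != 0.
  by apply: contraNneq r0 => ->; rewrite mulr0 !mul0r oppr0.
have opp_notin (x : F) : x \notin Fq q -> - x \notin Fq q.
  by rewrite !inE (FrobeniusqN hp hq hF) eqr_opp.
have nx1 := opp_notin _ (fl_x_notin_Fq hp hq hF hd l1q x1_0).
have nx2 := opp_notin _ (fl_x_notin_Fq hp hq hF hd l2q x2_0).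
rewrite /fl_lines /fl_P -/x1 -/x2 !sigma_pt in SE.
(* If x1 = x2, then l' and l'' are the same join, and [S] has at most three lines. *)
have x12 : x1 != x2.
  apply: contra_eq_neq cardS => x12; rewrite SE x12 [(_ + pt _ _ _)%VS]addvC -setUA setUid.
  by rewrite setUC cardsU1 cards2; case: (_ \notin _); case: (ln _ _ _ != _).
have sS : {subset S <= codom (quad_line x1 x2)}.
  move=> L; rewrite SE !inE -!orbA => /or4P[] /eqP ->; apply/codomP.
  - by exists (false, false).
  - by exists (false, true).
  - by exists (true, false).
  - by exists (true, true).
have dims := And4 (bm_unital_dim AU) (bm_unital_dim BU)
  (bm_unital_dim CU) (bm_unital_dim DU).
have two0 := two_neq0 hp hk hq hF hodd.
have ncyc X Y Z W :=
  @no_four_cycle F x1 x2 two0 x1_0 x2_0 x12 q a b X Y Z W S nx1 nx2 sS.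
have [dA dB dC dD] := dims; have [nABC nABD nACD nBCD] := nc.
(* The pair of joins left out by the 4-cycle meets in a diagonal point assumed to be on the unital.
   The second and third cases reduce to [no_four_cycle] by relabelling the vertices as A, C, B, D
   and as A, D, B, C. *)
have [S4|S4|S4] := quadrangle_four_edges dims nc nconc cardS sST.
- by move: d1; apply/negP/ncyc.
- have [AB CD AD BC] := S4; move: d2; apply/negP.
  apply: ncyc => //.
  + split=> //.
    - by rewrite noncollinear_swapr.
    - by rewrite noncollinear_swapl.
  + by split; rewrite // addvC.
- have [AB CD AC BD] := S4; move: d3; apply/negP.
  apply: ncyc => //.
  + split=> //.
    - by rewrite noncollinear_swapr.
    - by rewrite noncollinear_swapr.
    - by rewrite noncollinear_swapl noncollinear_swapr.
  + by split; rewrite // addvC.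
Qed.
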